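(* Let $(\Omega,\mathcal F,\mathbb P)$ be a nonatomic probability space and $0\le p\le\infty$. Let $\mathcal A\subset L^p$ be an acceptance set containing $0$ and $S=(S_0,S_T)$ a traded asset. The following statements hold: (i) if $\rho_{\mathcal A,S}$ is cash subadditive, then $S_T-S_01_\Omega\in\overline{\mathcal A}$; (ii) if $\mathcal A$ is coherent and $S_T-S_01_\Omega\in\mathcal A$, then $\rho_{\mathcal A,S}$ is cash subadditive. In particular, if $\mathcal A$ is closed and coherent, then $\rho_{\mathcal A,S}$ is cash subadditive if and only if $S_T-S_01_\Omega\in\mathcal A$.
   Context: $L^p=L^p(\Omega,\mathcal F,\mathbb P)$ carries its usual topology (convergence in probability for $p=0$, the metric $\mathbb E[|X-Y|^p]$ for $0<p<1$, the usual norm for $1\le p\le\infty$) and the almost sure order with positive cone $L^p_+$; $\overline{\mathcal A}$ is the closure. An acceptance set is a nonempty proper subset $\mathcal A\subset L^p$ such that $X\in\mathcal A$ and $Y\ge X$ imply $Y\in\mathcal A$; it is coherent if it is a convex cone (closed under multiplication by all $\lambda\ge0$). A traded asset is a pair $S=(S_0,S_T)$ with $S_0>0$ real and $S_T\in L^p_+$ nonzero. The risk measure is $\rho_{\mathcal A,S}(X)=\inf\{m\in\mathbb R : X+\frac{m}{S_0}S_T\in\mathcal A\}\in\mathbb R\cup\{\pm\infty\}$ with $\inf\emptyset=\infty$. A function $\rho:L^p\to\mathbb R\cup\{\pm\infty\}$ is cash subadditive if it is decreasing ($X\le Y$ implies $\rho(X)\ge\rho(Y)$) and $\rho(X+\lambda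 1_\Omega)\ge\rho(X)-\lambda$ for all $\lambda>0$ and $X\in L^p$. *)

(* Defs.v *)
From HB Require Import structures.
From mathcomp Require Import all_boot all_order all_algebra.
From mathcomp Require Import all_classical all_reals.
From mathcomp Require Import interval_inference ereal topology metric_structure.
From mathcomp Require Import normedtype numfun exp measure measurable_realfun.
From mathcomp Require Import lebesgue_measure lebesgue_integral ess_sup_inf.
From mathcomp Require Import convex hoelder probability.
Set Implicit Arguments.
Unset Strict Implicit.
Unset Printing Implicit Defensive.
Import Order.TTheory GRing.Theory Num.Theory.
Import numFieldNormedType.Exports.
Local Open Scope classical_set_scope.
Local Open Scope ring_scope.
Local Open Scope quotient_scope.

Section L0.
Context d (T : measurableType d) (R : realType) (P : probability T R).

Definition L0 : Type := {mfun_ P, T >-> R}.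
HB.instance Definition _ := Choice.on L0.
HB.instance Definition _ := EqQuotient.on L0.

Definition toL0 (f : {mfun T >-> R}) : L0 := \pi_L0 f.

Definition L0_repr (X : L0) : {mfun T >-> R} := repr X.

Definition L0_fun (X : L0) : T -> R := L0_repr X.
Coercion L0_fun : L0 >-> Funclass.

Lemma measurable_L0_fun (X : L0) : measurable_fun [set: T] X.
Proof. exact: measurable_funPT. Qed.

Lemma L0_reprK X : toL0 (L0_repr X) = X.
Proof. exact: reprK. Qed.

Lemma toL0_eq (f g : {mfun T >-> R}) :
  toL0 f = toL0 g <-> {ae P, forall x, f x = g x}.
Proof.
split=> [/eqP|h].
  rewrite /toL0 eqmodE => /asboolP; apply: filterS => x; exact.
apply/eqP; rewrite /toL0 eqmodE; apply/asboolP.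
by apply: filterS h => x fg _.
Qed.

Lemma L0_repr_ae (f : {mfun T >-> R}) :
  {ae P, forall x, L0_repr (toL0 f) x = f x}.
Proof. by apply/toL0_eq; rewrite L0_reprK. Qed.

Definition L0_add (X Y : L0) := toL0 (L0_repr X + L0_repr Y).
Definition L0_opp (X : L0) := toL0 (- L0_repr X).
Definition L0_scale (a : R) (X : L0) := toL0 (a *: L0_repr X).

Let addE (f g : {mfun T >-> R}) : L0_add (toL0 f) (toL0 g) = toL0 (f + g).
Proof.
apply/toL0_eq; have := L0_repr_ae g; have := L0_repr_ae f.
apply: filterS2 => x hf hg.
have -> : (L0_repr (toL0 f) + L0_repr (toL0 g)) x =
  (L0_repr (toL0 f) x : R) + L0_repr (toL0 g) x by [].
by rewrite hf hg.
Qed.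

Let oppE (f : {mfun T >-> R}) : L0_opp (toL0 f) = toL0 (- f).
Proof.
apply/toL0_eq; have := L0_repr_ae f.
apply: filterS => x hf.
have -> : (- L0_repr (toL0 f)) x = - (L0_repr (toL0 f) x : R) by [].
by rewrite hf.
Qed.

Let scaleE a (f : {mfun T >-> R}) : L0_scale a (toL0 f) = toL0 (a *: f).
Proof.
apply/toL0_eq; have := L0_repr_ae f.
apply: filterS => x hf.
have -> : (a *: L0_repr (toL0 f)) x = a * (L0_repr (toL0 f) x : R) by [].
by rewrite hf.
Qed.

Let addA : associative L0_add.
Proof.
move=> X Y Z; rewrite -(L0_reprK X) -(L0_reprK Y) -(L0_reprK Z).
by rewrite !addE addrA.
Qed.

Let addC : commutative L0_add.
Proof. by move=> X Y; rewrite /L0_add addrC. Qed.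

Let add0 : left_id (toL0 0) L0_add.
Proof. by move=> X; rewrite -(L0_reprK X) addE add0r. Qed.

Let addN : left_inverse (toL0 0) L0_opp L0_add.
Proof. by move=> X; rewrite -(L0_reprK X) oppE addE addNr. Qed.

HB.instance Definition _ := GRing.isZmodule.Build L0 addA addC add0 addN.

Let scaleA a b X : L0_scale a (L0_scale b X) = L0_scale (a * b) X.
Proof. by rewrite -(L0_reprK X) !scaleE scalerA. Qed.

Let scale1 : left_id 1 L0_scale.
Proof. by move=> X; rewrite -(L0_reprK X) scaleE scale1r. Qed.

Let scaleDr : right_distributive L0_scale +%R.
Proof.
move=> a X Y; rewrite -(L0_reprK X) -(L0_reprK Y).
by rewrite [toL0 _ + toL0 _]addE !scaleE [toL0 _ + toL0 _]addE scalerDr.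
Qed.

Let scaleDl X : {morph L0_scale^~ X : a b / a + b}.
Proof.
move=> a b; rewrite -(L0_reprK X) !scaleE [toL0 _ + toL0 _]addE.
by rewrite scalerDl.
Qed.

HB.instance Definition _ :=
  GRing.Zmodule_isLmodule.Build R L0 scaleA scale1 scaleDr scaleDl.

Lemma toL0_0 : toL0 0 = 0. Proof. by []. Qed.

Lemma toL0D (f g : {mfun T >-> R}) : toL0 (f + g) = toL0 f + toL0 g.
Proof. by rewrite -addE. Qed.

Lemma toL0N (f : {mfun T >-> R}) : toL0 (- f) = - toL0 f.
Proof. by rewrite -oppE. Qed.

Lemma toL0Z a (f : {mfun T >-> R}) : toL0 (a *: f) = a *: toL0 f.
Proof. by rewrite -scaleE. Qed.

Lemma L0_funP (X Y : L0) : X = Y <-> {ae P, forall x, X x = Y x}.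
Proof. by rewrite -{1}(L0_reprK X) -{1}(L0_reprK Y) toL0_eq. Qed.

Lemma L0_fun0 : {ae P, forall x, L0_fun 0 x = 0}.
Proof. exact: L0_repr_ae. Qed.

Lemma L0_funD (X Y : L0) : {ae P, forall x, L0_fun (X + Y) x = X x + Y x}.
Proof. exact: L0_repr_ae. Qed.

Lemma L0_funN (X : L0) : {ae P, forall x, L0_fun (- X) x = - X x}.
Proof. exact: L0_repr_ae. Qed.

Lemma L0_funZ a (X : L0) : {ae P, forall x, L0_fun (a *: X) x = a * X x}.
Proof. exact: L0_repr_ae. Qed.

End L0.

Section Lp_gauge.
Context d (T : measurableType d) (R : realType) (P : probability T R).
Local Open Scope ereal_scope.

(* The metric of L^p is (X, Y) |-> Lp_gauge P p (X - Y). For p = 0 this is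
   E[min(|X - Y|, 1)], which metrizes convergence in probability. *)
Definition Lp_gauge (p : \bar R) (f : T -> R) : \bar R :=
  if p == 0 then \int[P]_x (Num.min `|f x| 1)%:E
  else if p < 1 then \int[P]_x (`|f x| `^ fine p)%:E
  else 'N[P]_p[EFin \o f].

Let mnorm (f : T -> R) : measurable_fun setT f ->
  measurable_fun setT (fun x => `|f x|%R).
Proof. by move=> mf; exact: measurableT_comp. Qed.

Let mmin (f : T -> R) : measurable_fun setT f ->
  measurable_fun setT (fun x => (Num.min `|f x| 1)%:E).
Proof.
by move=> mf; apply/measurable_EFinP; apply: measurable_minr => //; exact: mnorm.
Qed.

Let mpow (f : T -> R) r : measurable_fun setT f ->
  measurable_fun setT (fun x => (`|f x| `^ r)%:E).
Proof.
move=> mf; apply/measurable_EFinP.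
apply: (@measurableT_comp _ _ _ _ _ _ (@powR R ^~ r)) => //; exact: mnorm.
Qed.

Let min_ge0 (x : R) : (0 <= Num.min `|x| 1)%R.
Proof. by rewrite le_min normr_ge0 ler01. Qed.

Lemma Lp_gauge_ge0 p (f : T -> R) : 0 <= Lp_gauge p f.
Proof.
rewrite /Lp_gauge; case: ifPn => _; [|case: ifPn => _].
- by apply: integral_ge0 => x _; rewrite lee_fin.
- by apply: integral_ge0 => x _; rewrite lee_fin powR_ge0.
- exact: Lnorm_ge0.
Qed.

Lemma Lp_gauge0 p : 0 <= p -> Lp_gauge p (cst 0%R) = 0.
Proof.
move=> p_ge0; rewrite /Lp_gauge; case: eqVneq => [_|p0]; [|case: ifPn => p1].
- by apply: integral0_eq => x _; rewrite normr0 min_l.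
- apply: integral0_eq => x _; rewrite normr0 powR0//.
  by case: p p0 p_ge0 p1 => [r| |].
- by rewrite Lnorm0.
Qed.

Lemma Lp_gaugeN p (f : T -> R) : Lp_gauge p (\- f)%R = Lp_gauge p f.
Proof.
rewrite /Lp_gauge; case: ifPn => _; [|case: ifPn => _].
- by apply: eq_integral => x _ /=; rewrite normrN.
- by apply: eq_integral => x _ /=; rewrite normrN.
- by rewrite -(oppe_Lnorm P (EFin \o f)).
Qed.

Lemma Lp_gauge_ae p (f g : T -> R) :
  measurable_fun setT f -> measurable_fun setT g ->
  {ae P, forall x, f x = g x} -> Lp_gauge p f = Lp_gauge p g.
Proof.
move=> mf mg fg; rewrite /Lp_gauge; case: ifPn => _; [|case: ifPn => _].
- apply: ge0_ae_eq_integral => //; [exact: mmin|exact: mmin|].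
  by apply: filterS fg => x /= -> _.
- apply: ge0_ae_eq_integral => //; [exact: mpow|exact: mpow|].
  by apply: filterS fg => x /= -> _.
- rewrite unlock /Lnorm; case: p => [r| |].
  + congr (_ `^ _); apply: ge0_ae_eq_integral => //.
    * exact: mpow.
    * exact: mpow.
    * by move=> x _; exact: poweR_ge0.
    * by move=> x _; exact: poweR_ge0.
    * by apply: filterS fg => x /= -> _.
  + by case: ifPn => // _; apply: eq_ess_sup; apply: filterS fg => x /= ->.
  + by case: ifPn => // _; apply: eq_ess_inf;
      apply: filterS fg => x /= ->.
Qed.

Let powRD_le (r a b : R) : (0 < r <= 1 -> 0 <= a -> 0 <= b ->
  (a + b) `^ r <= a `^ r + b `^ r)%R.
Proof.
move=> /andP[r0 r1] a0 b0.
have [s0|] := ltP 0%R (a + b)%R; last first.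
  move=> s0; have a00 : a = 0%R.
    by apply/eqP; rewrite eq_le a0 andbT (le_trans _ s0)// lerDl.
  have b00 : b = 0%R.
    by apply/eqP; rewrite eq_le b0 andbT (le_trans _ s0)// lerDr.
  by rewrite a00 b00 addr0 lerDl powR_ge0.
have key c : (0 <= c <= a + b -> c / (a + b) * (a + b) `^ r <= c `^ r)%R.
  move=> /andP[]; rewrite le_eqVlt => /predU1P[<-|c0] cs.
    by rewrite mul0r mul0r powR_ge0.
  have -> : (c `^ r = (c / (a + b)) `^ r * (a + b) `^ r)%R.
    by rewrite -powRM ?divr_ge0 ?(ltW s0) ?(ltW c0)// divfK// gt_eqF.
  rewrite ler_wpM2r ?powR_ge0//; apply: ger1_powR => //.
  by rewrite divr_gt0//= ler_pdivrMr// mul1r.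
rewrite -[leLHS]mul1r -[X in (X * _)%R](@divff _ (a + b)%R) ?gt_eqF//.
rewrite [((a + b) / _)%R]mulrDl mulrDl lerD//; apply: key.
  by rewrite a0 lerDl.
by rewrite b0 lerDr.
Qed.

Lemma Lp_gaugeD p (f g : T -> R) : 0 <= p ->
  measurable_fun setT f -> measurable_fun setT g ->
  Lp_gauge p (f \+ g)%R <= Lp_gauge p f + Lp_gauge p g.
Proof.
move=> p_ge0 mf mg.
have mfg : measurable_fun setT (f \+ g)%R by exact: measurable_funD.
rewrite /Lp_gauge; case: eqVneq => [_|p0]; [|case: (ltP p 1) => p1].
- rewrite -ge0_integralD//; [|exact: mmin|exact: mmin].
  apply: ge0_le_integral => //; [exact: mmin| |].
    by apply: emeasurable_funD; exact: mmin.
  move=> x _; rewrite -EFinD lee_fin ge_min.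
  have [fx|fx] := leP `|f x|%R 1%R; have [gx|gx] := leP `|g x|%R 1%R.
  + by rewrite ler_normD.
  + by rewrite lerDr normr_ge0 orbT.
  + by rewrite lerDl normr_ge0 orbT.
  + by rewrite lerDl ler01 orbT.
- have [r rE] : exists r, p = r%:E by case: p p_ge0 p0 p1 => // r; exists r.
  have r0 : (0 < r)%R by rewrite -lte_fin -rE lt0e p0.
  have r1 : (r <= 1)%R by rewrite -lee_fin -rE ltW.
  rewrite rE /= -ge0_integralD//; [|exact: mpow|exact: mpow].
  apply: ge0_le_integral => //; [exact: mpow| |].
    by apply: emeasurable_funD; exact: mpow.
  move=> x _; rewrite -EFinD lee_fin.
  apply: (le_trans _ (powRD_le _ _ _)) => //; last by rewrite r0.
  by apply: ge0_ler_powR; rewrite ?nnegrE ?addr_ge0 ?ler_normD// ltW.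
- exact: eminkowski.
Qed.

Lemma Lp_gaugeZ_lty p a (f : T -> R) : 0 <= p -> measurable_fun setT f ->
  Lp_gauge p f < +oo -> Lp_gauge p (fun x => a * f x)%R < +oo.
Proof.
move=> p_ge0 mf; rewrite /Lp_gauge.
have maf : measurable_fun setT (fun x => a * f x)%R by exact: measurable_funM.
case: eqVneq => [_ _|p0]; [|case: (ltP p 1) => p1].
- apply: (@le_lt_trans _ _ (\int[P]_x (cst 1%:E x))).
    apply: ge0_le_integral => //; [exact: mmin|].
    by move=> x _; rewrite lee_fin ge_min lexx orbT.
  rewrite integral_cst// mul1e.
  by apply: (le_lt_trans (probability_le1 P measurableT)); rewrite ltry.
- move=> foo; under eq_integral do rewrite normrM powRM// EFinM.
  rewrite ge0_integralZl//; [|exact: mpow].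
  by rewrite lte_mul_pinfty// lee_fin powR_ge0.
- move=> foo.
  have fL : f \in Lfun P p by rewrite inE; apply/andP; split; rewrite inE.
  have := LnormZ (Lfun_Sub p1 fL) a.
  rewrite [X in X = _ -> _](_ : _ = 'N[P]_p[EFin \o (fun x => a * f x)%R])//.
  by move=> ->; rewrite lte_mul_pinfty.
Qed.

Lemma Lp_gauge_eq0 p (f : T -> R) : 0 <= p -> measurable_fun setT f ->
  Lp_gauge p f = 0 -> {ae P, forall x, f x = 0%R}.
Proof.
move=> p_ge0 mf; rewrite /Lp_gauge; case: eqVneq => [_|p0]; [|case: (ltP p 1) => p1].
- move=> f0.
  have : ae_eq P setT (fun x => (Num.min `|f x| 1)%:E) (cst 0).
    apply/ae_eq_integral_abs => //; first exact: mmin.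
    by rewrite -[RHS]f0; apply: eq_integral => x _; rewrite gee0_abs// lee_fin.
  apply: filterS => x /(_ I) /= [] /eqP.
  case: leP => _; last by rewrite oner_eq0.
  by rewrite normr_eq0 => /eqP.
- move=> f0.
  have : ae_eq P setT (fun x => (`|f x| `^ fine p)%:E) (cst 0).
    apply/ae_eq_integral_abs => //; first exact: mpow.
    rewrite -[RHS]f0; apply: eq_integral => x _.
    by rewrite gee0_abs// lee_fin powR_ge0.
  by apply: filterS => x /(_ I) /= [] /powR_eq0_eq0/eqP; rewrite normr_eq0 => /eqP.
- move/Lnorm_eq0_eq0 => H.
  have : ae_eq P setT (EFin \o f) (cst 0).
    by apply: H; [exact/measurable_EFinP|rewrite lt0e p0].
  by apply: filterS => x /(_ I) [].
Qed.

End Lp_gauge.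

Section Lp.
Context d (T : measurableType d) (R : realType) (P : probability T R).
Variables (p : \bar R) (p0 : (0 <= p)%E).

(* Lp_gauge P 0 is at most 1 and so never takes the value +oo: for p = 0
   the space is the whole of L0 P. *)
Definition Lp_pred : {pred L0 P} := [pred X : L0 P | (Lp_gauge P p X < +oo)%E].

(* The proof of 0 <= p is a parameter because the vector space and metric
   structures below depend on it. *)
Record Lp (p_ge0 : (0 <= p)%E) := MkLp {
  Lp_val :> L0 P ;
  Lp_valP : Lp_val \in Lp_pred }.

HB.instance Definition _ := [isSub for @Lp_val p0].
HB.instance Definition _ := [Choice of Lp p0 by <:].

Let gauge_ae (X : L0 P) (f : T -> R) : measurable_fun [set: T] f ->
  {ae P, forall x, X x = f x} -> Lp_gauge P p X = Lp_gauge P p f.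
Proof. by move=> mf; apply: Lp_gauge_ae => //; exact: measurable_L0_fun. Qed.

Let gaugeN (X : L0 P) : Lp_gauge P p (L0_fun (- X)) = Lp_gauge P p X.
Proof.
rewrite -[RHS]Lp_gaugeN; apply: gauge_ae; last exact: L0_funN.
by apply: measurableT_comp => //; exact: measurable_L0_fun.
Qed.

Let gaugeD (X Y : L0 P) :
  (Lp_gauge P p (L0_fun (X + Y)%R) <= Lp_gauge P p X + Lp_gauge P p Y)%E.
Proof.
have mX := measurable_L0_fun X; have mY := measurable_L0_fun Y.
rewrite (gauge_ae _ (L0_funD X Y)); first exact: Lp_gaugeD.
exact: measurable_funD.
Qed.

Let gauge0 : Lp_gauge P p (L0_fun (0 : L0 P)) = 0%E.
Proof. by rewrite (gauge_ae _ (L0_fun0 P))// Lp_gauge0. Qed.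

Lemma Lp_submod_closed : submod_closed Lp_pred.
Proof.
split=> [|a X Y]; rewrite !inE; first by rewrite gauge0 ltry.
move=> fX fY; apply: (le_lt_trans (gaugeD _ _)); rewrite lte_add_pinfty//.
have mX := measurable_L0_fun X.
rewrite (gauge_ae _ (L0_funZ a X)); last exact: measurable_funM.
exact: Lp_gaugeZ_lty.
Qed.

HB.instance Definition _ :=
  GRing.isSubmodClosed.Build R (L0 P) Lp_pred Lp_submod_closed.
HB.instance Definition _ := [SubChoice_isSubLmodule of Lp p0 by <:].

Definition Lp_dist (X Y : Lp p0) : R := fine (Lp_gauge P p (L0_fun (Lp_val (X - Y)))).

Let Lp_distE X Y : (Lp_dist X Y)%:E = Lp_gauge P p (L0_fun (Lp_val (X - Y))).
Proof.
rewrite fineK// ge0_fin_numE ?Lp_gauge_ge0//.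
exact: Lp_valP.
Qed.

Let Lp_distxx X : Lp_dist X X = 0.
Proof. by apply: EFin_inj; rewrite Lp_distE subrr gauge0. Qed.

Let Lp_dist_eq0 X Y : Lp_dist X Y = 0 -> X = Y.
Proof.
move=> XY; have h : Lp_gauge P p (L0_fun (Lp_val (X - Y))) = 0%E.
  by rewrite -Lp_distE XY.
have XY0 := Lp_gauge_eq0 p0 (measurable_L0_fun _) h.
apply/eqP; rewrite -subr_eq0; apply/eqP/val_inj/L0_funP.
have := L0_fun0 P; have := XY0.
by apply: filterS2 => x -> ->.
Qed.

Let Lp_dist_sym X Y : Lp_dist X Y = Lp_dist Y X.
Proof.
apply: EFin_inj; rewrite !Lp_distE -gaugeN.
by have <- : Lp_val (- (X - Y)) = - Lp_val (X - Y) by []; rewrite opprB.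
Qed.

Let Lp_dist_triangle Y X Z : Lp_dist X Z <= Lp_dist X Y + Lp_dist Y Z.
Proof.
rewrite -lee_fin EFinD !Lp_distE -[X in (X - Z)](subrK Y) -addrA.
exact: gaugeD.
Qed.

HB.instance Definition _ := isMetric.Build R (Lp p0)
  Lp_distxx Lp_dist_eq0 Lp_dist_sym Lp_dist_triangle.

End Lp.

Section Lp_order.
Context d (T : measurableType d) (R : realType) (P : probability T R).
Variables (p : \bar R) (p0 : (0 <= p)%E).

Definition Lp_le (X Y : Lp P p0) : Prop := {ae P, forall x, X x <= Y x}.

Let cst1_Lp : toL0 P (cst 1 : {mfun T >-> R}) \in Lp_pred p.
Proof.
have m1 : measurable_fun [set: T] (@cst T R 1) by exact: measurable_cst.
rewrite inE (Lp_gauge_ae _ (measurable_L0_fun _) m1); last exact: L0_repr_ae.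
have P1 : (P [set: T] < +oo)%E.
  by apply: (le_lt_trans (probability_le1 P measurableT)); rewrite ltry.
rewrite /Lp_gauge; case: eqVneq => [_|pneq0]; [|case: (ltP p 1%E) => p1].
- under eq_integral do rewrite normr1 minxx.
  by rewrite integral_cst// mul1e.
- under eq_integral do rewrite normr1 powR1.
  by rewrite integral_cst// mul1e.
- case: p p0 pneq0 p1 => [r| |]// r0 _ r1.
    by have := Lfun_cst P 1 r; rewrite inE => /andP[_]; rewrite inE.
  rewrite unlock /Lnorm; case: ifPn => // _.
  apply: (@le_lt_trans _ _ 1%E); last by rewrite ltry.
  by apply/ess_supP/nearW => x /=; rewrite normr1.
Qed.

Definition Lp_one : Lp P p0 := MkLp p0 cst1_Lp.

End Lp_order.

Definition nonatomic d (T : measurableType d) (R : realType)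
    (P : probability T R) : Prop :=
  forall A, measurable A -> (0 < P A)%E ->
    exists B, [/\ measurable B, B `<=` A, (0 < P B)%E & (P B < P A)%E].

Section risk_measures.
Context d (T : measurableType d) (R : realType) (P : probability T R).
Variables (p : \bar R) (p0 : (0 <= p)%E).

Definition acceptance_set (A : set (Lp P p0)) : Prop :=
  [/\ A !=set0, A != [set: Lp P p0] &
      forall X Y, A X -> Lp_le X Y -> A Y].

Definition coherent (A : set (Lp P p0)) : Prop :=
  convex_set (A : set (convex_lmodType (Lp P p0))) /\
  forall (a : R) X, 0 <= a -> A X -> A (a *: X).

Record traded_asset := TradedAsset {
  price : R ;
  payoff : Lp P p0 ;
  price_gt0 : 0 < price ;
  payoff_ge0 : Lp_le 0 payoff ;
  payoff_neq0 : payoff != 0 }.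

Definition risk_measure (A : set (Lp P p0)) (S : traded_asset)
    (X : Lp P p0) : \bar R :=
  ereal_inf [set m%:E | m in [set m : R | A (X + (m / price S) *: payoff S)]].

Definition cash_subadditive (rho : Lp P p0 -> \bar R) : Prop :=
  (forall X Y, Lp_le X Y -> (rho Y <= rho X)%E) /\
  (forall (lambda : R) X, 0 < lambda ->
     (rho X - lambda%:E <= rho (X + lambda *: Lp_one P p0)%R)%E).

End risk_measures.

(* Main.v *)
(* Write s = S_0 and Z = S_T. Since 0 lies in A, rho(0) <= 0, so cash
   subadditivity applied at -s 1 gives rho(-s 1) <= s, that is,
   Z - s 1 + c Z lies in A for every c > 0; letting c -> 0 puts Z - s 1 in the
   closure of A. Conversely, when A is a convex cone containing Z - s 1, adding
   (l/s)(Z - s 1) to an acceptable position X + l 1 + (m/s) Z shows that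
   X + ((m + l)/s) Z is acceptable, so rho(X) <= m + l. *)
Require Import Defs.
From mathcomp Require Import all_boot all_order all_algebra.
From mathcomp Require Import all_classical all_reals topology measure probability.
From mathcomp Require Import ereal normedtype.
From mathcomp Require Import sequences exp measurable_realfun lebesgue_measure.
From mathcomp Require Import lebesgue_integral hoelder convex.
Set Implicit Arguments.
Unset Strict Implicit.
Unset Printing Implicit Defensive.
Import Order.TTheory GRing.Theory Num.Theory.
Import numFieldNormedType.Exports.
Local Open Scope classical_set_scope.
Local Open Scope ring_scope.

Section Lp_scaling.
Context d (T : measurableType d) (R : realType) (P : probability T R).

(** The truncated integrand is not homogeneous, so [c] comes from dominated convergence:
    [min(|f/(n+1)|, 1)] tends to 0 pointwise and is dominated by 1, integrable under a
    probability. *)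
Lemma L0_gaugeZ_small (f : T -> R) (e : R) :
  measurable_fun [set: T] f -> 0 < e ->
  exists2 c : R, 0 < c & (Lp_gauge P 0 (fun x => (c * f x)%R) < e%:E)%E.
Proof.
move=> mf e0; rewrite /Lp_gauge eqxx.
pose g n x := (Num.min `|n.+1%:R^-1 * f x| 1)%:E : \bar R.
have mg n : measurable_fun [set: T] (g n).
  apply/measurable_EFinP; apply: measurable_minr => //.
  by apply: measurableT_comp => //; exact: measurable_funM.
have cg x : g ^~ x @ \oo --> (0 : \bar R)%E.
  apply/fine_cvgP; split; first exact: nearW.
  have h : `|n.+1%:R^-1 * f x| @[n --> \oo] --> (0 : R).
    rewrite -(normr0 R); apply: cvg_norm.
    by rewrite -(mul0r (f x)); apply: cvgMl; exact: cvg_harmonic.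
  apply: (squeeze_cvgr _ (cvg_cst 0) h); apply: nearW => n /=.
  by rewrite le_min normr_ge0 ler01 ge_min lexx.
have gle x n : (`|g n x| <= cst 1%E x)%E.
  rewrite /g abse_EFin lee_fin ger0_norm; first by rewrite ge_min lexx orbT.
  by rewrite le_min normr_ge0 ler01.
have [_ _] : [/\ P.-integrable setT (cst 0%E),
    [sequence (\int[P]_x `|g n x - cst 0 x|)%E]_n @ \oo --> 0%E &
    [sequence (\int[P]_x g n x)%E]_n @ \oo --> (\int[P]_x (cst 0 x))%E].
  apply: (@dominated_convergence _ _ _ P _ measurableT g _ (cst 1%E)) => //.
  - by apply: nearW => x _; exact: cg.
  - exact: finite_measure_integrable_cst.
  - by apply: nearW.
rewrite integral0 => /(_ [set y | (y < e%:E)%E]) []/=.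
  by apply: open_nbhs_nbhs; split; [exact: open_ereal_lt_ereal|rewrite /= lte_fin].
move=> n _ /(_ n (leqnn n)) gn; exists n.+1%:R^-1; first by rewrite invr_gt0.
exact: gn.
Qed.

(** For [p > 0] the gauge is positively homogeneous, of degree [p] below 1 and of degree 1 from 1
    on, so [c] can be written down explicitly. *)
Lemma Lp_gaugeZ_small (p : \bar R) (f : T -> R) (e : R) : (0 <= p)%E ->
  measurable_fun [set: T] f -> (Lp_gauge P p f < +oo)%E -> 0 < e ->
  exists2 c : R, 0 < c & (Lp_gauge P p (fun x => (c * f x)%R) < e%:E)%E.
Proof.
move=> p0 mf fp e0.
have [->|pn0] := eqVneq p 0%E; first exact: L0_gaugeZ_small.
have [G [G0 fG]] : exists G : R, 0 <= G /\ Lp_gauge P p f = G%:E.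
  exists (fine (Lp_gauge P p f)); rewrite fine_ge0 ?Lp_gauge_ge0//.
  by rewrite fineK// ge0_fin_numE ?Lp_gauge_ge0.
(* Dividing by [G + 1] instead of [G] covers [G = 0] and makes the bound below strict. *)
have eG0 : 0 < e / (G + 1) by rewrite divr_gt0// ltr_wpDl.
have eGlt : e / (G + 1) * G < e.
  by rewrite mulrAC ltr_pdivrMr ?ltr_wpDl// ltr_pM2l// ltrDl.
move: fp fG; rewrite /Lp_gauge (negbTE pn0).
have [p1|p1] := ltP p 1%E => fp fG.
- set r := fine p.
  have r0 : 0 < r.
    by rewrite /r fine_gt0// lt0e pn0 p0/= (lt_trans p1) ?ltry.
  (* Scaling by [c] multiplies the gauge by [c ^ r], hence the [r]-th root. *)
  have [c c0 cr] : exists2 c : R, 0 < c & c `^ r = e / (G + 1).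
    exists ((e / (G + 1)) `^ r^-1); first exact: powR_gt0.
    by rewrite -powRrM mulVf ?gt_eqF// powRr1// ltW.
  exists c => //.
  under eq_integral do rewrite normrM powRM// EFinM.
  rewrite ge0_integralZl//; last first.
    apply/measurable_EFinP.
    apply: (@measurableT_comp _ _ _ _ _ _ (@powR R ^~ r)) => //.
    exact: measurableT_comp.
  by rewrite fG (ger0_norm (ltW c0)) cr -EFinM lte_fin.
- exists (e / (G + 1)) => //.
  have fL : f \in Lfun P p by rewrite inE; apply/andP; split; rewrite inE.
  have := LnormZ (Lfun_Sub p1 fL) (e / (G + 1)).
  rewrite [X in X = _ -> _](_ : _ =
    'N[P]_p[EFin \o (fun x => e / (G + 1) * f x)%R]%E)//.
  by move=> ->; rewrite fG ger0_norm ?ltW// -EFinM lte_fin.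
Qed.

End Lp_scaling.

Section Lp_space.
Context {d} {T : measurableType d} {R : realType} {P : probability T R}.
Context {p : \bar R} {p0 : (0 <= p)%E}.
Implicit Types (A : set (Lp P p0)) (X Y Z : Lp P p0) (S : traded_asset P p0).

Lemma Lp_leDr X Y : Lp_le 0 Y -> Lp_le X (X + Y).
Proof.
(* The chosen representative of the class 0 vanishes only almost surely, so it contributes a null
   set of its own. *)
rewrite /Lp_le => Y0; have := L0_fun0 P; have := L0_funD (Lp_val X) (Lp_val Y).
move: Y0; apply: filterS3 => x Y0 XY z0.
by rewrite XY lerDl -[leLHS]z0.
Qed.

Lemma Lp_leD2r X Y Z : Lp_le X Y -> Lp_le (X + Z) (Y + Z).
Proof.
rewrite /Lp_le.
have := L0_funD (Lp_val X) (Lp_val Z); have := L0_funD (Lp_val Y) (Lp_val Z).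
by apply: filterS3 => x YZ XZ XY; rewrite [leLHS]XZ [leRHS]YZ lerD2r.
Qed.

Lemma Lp_leZ (a : R) X : 0 <= a -> Lp_le 0 X -> Lp_le 0 (a *: X).
Proof.
rewrite /Lp_le => a0 X0; have := L0_fun0 P; have := L0_funZ a (Lp_val X).
move: X0; apply: filterS3 => x X0 aX z0.
by rewrite [leLHS]z0 [leRHS]aX mulr_ge0//; rewrite -[leLHS]z0.
Qed.

Lemma mdist_addZ (a : R) X Y : mdist X (X + a *: Y) =
  fine (Lp_gauge P p (fun x => (a * Lp_val Y x)%R)).
Proof.
(* After the swap the difference is [X + a *: Y - X], which reduces to [a *: Y] with no sign
   left. *)
rewrite metric_sym; congr (fine _).
rewrite addrAC subrr add0r.
apply: Lp_gauge_ae; [exact: measurable_L0_fun| |exact: L0_funZ].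
by apply: measurable_funM => //; exact: measurable_L0_fun.
Qed.

(** The distance from [X] to [X + c *: Y] is the gauge of [c *: Y], so every ball around [X]
    contains such a point for some [c > 0]. *)
Lemma closure_addZ A X Y : (forall c : R, 0 < c -> A (X + c *: Y)) ->
  closure A X.
Proof.
move=> AXY B /nbhs_ballP[e /= e0 eB].
have [c c0 ce] := Lp_gaugeZ_small p0 (measurable_L0_fun _)
  (Lp_valP Y) e0.
exists (X + c *: Y); split; first exact: AXY.
apply: eB; rewrite ballEmdist /= mdist_addZ.
(* [fine] sends an infinite gauge to 0; the bound [ce] excludes that case. *)
rewrite -lte_fin fineK// ge0_fin_numE ?Lp_gauge_ge0//.
by apply: lt_trans ce _; rewrite ltry.
Qed.

(** The sum is the midpoint of [2 *: X] and [2 *: Y], both in the cone. *)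
Lemma coherentD A X Y : coherent A -> A X -> A Y -> A (X + Y).
Proof.
move=> [cA zA] AX AY.
have h0 : 0 <= (2^-1 : R) by rewrite invr_ge0.
have h1 : (2^-1 : R) <= 1 by rewrite invf_le1// ler1n.
have A2 Z : A Z -> (2 *: Z : convex_lmodType (Lp P p0)) \in A.
  by move=> AZ; rewrite inE; exact: zA.
have := cA _ _ (Itv01 h0 h1) (A2 _ AX) (A2 _ AY).
rewrite inE [X in A X -> _](_ : _ =
  2^-1 *: (2 *: X) + (1 - 2^-1) *: (2 *: Y))//.
have -> : 1 - 2^-1 = 2^-1 :> R by rewrite [X in X - _](splitr 1) mul1r addrK.
by rewrite !scalerA mulVf// !scale1r.
Qed.

Lemma risk_measure_le A S X (m : R) :
  A (X + (m / price S) *: payoff S) -> (risk_measure A S X <= m%:E)%E.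
Proof. by move=> AX; apply: ereal_inf_lbound; exists m. Qed.

(** The infimum need not be attained, but some acceptable [k] lies below [m], and passing from [k]
    to [m] adds a nonnegative multiple of the payoff. *)
Lemma risk_measure_lt A S X (m : R) : acceptance_set A ->
  (risk_measure A S X < m%:E)%E -> A (X + (m / price S) *: payoff S).
Proof.
move=> [_ _ upA] /ereal_inf_lt[_ [k Ak <-]]; rewrite lte_fin => km.
apply: upA Ak _.
have -> : X + (m / price S) *: payoff S =
    X + (k / price S) *: payoff S + ((m - k) / price S) *: payoff S.
  by rewrite -addrA -scalerDl -mulrDl [k + _]addrC subrK.
apply/Lp_leDr/Lp_leZ; last exact: payoff_ge0.
by rewrite divr_ge0 ?subr_ge0 ?ltW ?price_gt0.
Qed.

Lemma risk_measure_decreasing A S X Y : acceptance_set A ->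
  Lp_le X Y -> (risk_measure A S Y <= risk_measure A S X)%E.
Proof.
move=> [_ _ upA] XY; apply: le_ereal_inf_tmp => _ [m Am <-].
by apply/risk_measure_le/(upA _ _ Am)/Lp_leD2r.
Qed.

Lemma cash_subadditive_closure A S : acceptance_set A -> A 0 ->
  cash_subadditive (risk_measure A S) ->
  closure A (payoff S - price S *: Lp_one P p0).
Proof.
move=> accA A0 [_ subA].
have s0 := price_gt0 S.
have rho0 : (risk_measure A S 0%R <= 0)%E.
  by apply: risk_measure_le; rewrite mul0r scale0r addr0.
apply: (@closure_addZ _ _ (payoff S)) => c c0.
(* The excess [c * price S] gives the strict inequality that membership in [A] requires; divided by
   the price, the total becomes [1 + c]. *)
have : (risk_measure A S (- (price S *: Lp_one P p0))%R <
        (price S + c * price S)%:E)%E.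
  have := subA _ (- (price S *: Lp_one P p0)) s0; rewrite addNr => h.
  have := le_trans h rho0; rewrite leeBlDr// add0e => /le_lt_trans; apply.
  by rewrite lte_fin ltrDl mulr_gt0.
move=> /(risk_measure_lt accA).
rewrite -{2}[price S]mul1r -mulrDl mulfK ?gt_eqF// scalerDl scale1r.
by rewrite addrA [- _ + _]addrC.
Qed.

Lemma coherent_cash_subadditive A S : acceptance_set A -> coherent A ->
  A (payoff S - price S *: Lp_one P p0) ->
  cash_subadditive (risk_measure A S).
Proof.
move=> accA cohA AS; have s0 := price_gt0 S; split=> [X Y|lambda X l0].
  exact: risk_measure_decreasing.
apply: le_ereal_inf_tmp => _ [m Am <-].
rewrite leeBlDr// -EFinD; apply: risk_measure_le.
(* With this factor the cash part is exactly [- lambda *: Lp_one P p0], cancelling the added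
   cash. *)
have Al := cohA.2 (lambda / price S) _ (divr_ge0 (ltW l0) (ltW s0)) AS.
have := coherentD cohA Am Al.
rewrite [X in A X -> _](_ : _ = X + ((m + lambda) / price S) *: payoff S)//.
rewrite scalerBr scalerA divfK ?gt_eqF// mulrDl scalerDl.
by rewrite (addrAC X) addrACA subrr addr0 addrA.
Qed.

End Lp_space.

Theorem proposition5p2 (d : measure_display) (T : measurableType d)
    (R : realType) (P : probability T R) (p : \bar R) (p0 : (0 <= p)%E)
    (A : set (Lp P p0)) (S : traded_asset P p0) :
  nonatomic P -> acceptance_set A -> A 0 ->
  [/\ cash_subadditive (risk_measure A S) ->
        closure A (payoff S - price S *: Lp_one P p0),
      coherent A -> A (payoff S - price S *: Lp_one P p0) ->
        cash_subadditive (risk_measure A S) &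
      closed A -> coherent A ->
        (cash_subadditive (risk_measure A S) <->
         A (payoff S - price S *: Lp_one P p0))].
Proof.
move=> _ accA A0; split.
- exact: cash_subadditive_closure.
- exact: coherent_cash_subadditive.
- move=> clA cohA; split; last exact: coherent_cash_subadditive.
  by move=> /(cash_subadditive_closure accA A0)/clA.
Qed.
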